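(* Let $g\in\Gamma_d(q)$ and let $l(g)$ denote the word length of $g$ with respect to the generating set $S_{d,q}$. Then $l(g)=f(g)$, where $$f(g)=\min_{\sigma\in\Sigma_d}\ \max_{2\le i\le d}\ \bigl(m_{\sigma(1)}(g)+l_{\sigma(d)}(g)+A_{\sigma(i)}(g)\bigr),$$ with $A_{\sigma(d)}(g)=\sum_{j=1}^d m_{\sigma(j)}(g)$ and $A_{\sigma(i)}(g)=\sum_{j=2}^{i}m_{\sigma(j)}(g)+\sum_{k=i}^{d-1}l_{\sigma(k)}(g)$ for $2\le i\le d-1$. That is, $f$ is the word length function of $\Gamma_d(q)$ with respect to $S_{d,q}$.
   Context: **The group.** $d\ge 2$ and $q\ge 2$ are integers such that either $d\in\{2,3\}$, or $d\ge4$ and every prime divisor of $q$ is greater than $d-1$. $\mathcal L_q$ is a commutative ring of order $q$ with unit $1$ containing distinct elements $\lambda_1,\dots,\lambda_{d-1}$ whose pairwise differences are invertible if $d\ge3$. Let $\mathcal R=\mathcal L_q[t,(t+\lambda_1)^{-1},\dots,(t+\lambda_{d-1})^{-1}]$. $\Gamma_d(q)$ is the group of matrices $\begin{pmatrix}(t+\lambda_1)^{k_1}\cdots(t+\lambda_{d-1})^{k_{d-1}}&P\\0&1\end{pmatrix}$ with $k_i\in\mathbb Z$, $P\in\mathcal R$. The generating set $S_{d,q}$ (closed under inverses) consists of the matrices $\begin{pmatrix}t+\lambda_i&b\\0&1\end{pmatrix}^{\pm1}$ ($b\in\mathcal L_q$, $1\le i\le d-1$) and $\begin{pmatrix}(t+\lambda_i)(t+\lambda_j)^{-1}&-b(t+\lambda_j)^{-1}\\0&1\end{pmatrix}$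 ($b\in\mathcal L_q$, $i\ne j$ in $\{1,\dots,d-1\}$). **The Diestel-Leader graph.** Let $T$ be the $(q+1)$-regular tree, oriented so that each vertex $v$ has a unique predecessor $v^-$ and exactly $q$ successors (vertices $w$ with $w^-=v$). Any two vertices $v,w$ have a greatest common ancestor $v\curlywedge w$. With a basepoint $o$ and edge-path distance $d(\cdot,\cdot)$ (also written $d_{T}$), the height is $h(v)=d(v,o\curlywedge v)-d(o,o\curlywedge v)$. Let $T_1,\dots,T_d$ be copies of $T$ with basepoints $o_i$ and heights $h_i$. $DL_d(q)$ is the graph whose vertices are the tuples $(x_1,\dots,x_d)$ with $x_i$ a vertex of $T_i$ and $\sum_i h_i(x_i)=0$; two vertices $x,y$ are adjacent iff there are $i\ne j$ such that $x_i,y_i$ are adjacent in $T_i$, $x_j,y_j$ are adjacent in $T_j$, and $x_k=y_k$ for $k\ne i,j$. It is a theorem of Bartholdi, Neuhauser and Woess that the Cayley graph of $\Gamma_d(q)$ with respect to $S_{d,q}$ (edges joining $g$ and $gs$, $s\in S_{d,q}$) is $DL_d(q)$; fix such an identification, with the identity corresponding to $o=(o_1,\dots,o_d)$. **Projection.** If $g\in\Gamma_d(q)$ corresponds to the vertex $x=(x_1,\dots,x_d)$, put $m_i(g)=d(o_i,o_i\curlywedge x_i)$ and $l_i(g)=d(x_i,o_i\curlywedge x_i)$. Thus $m_i(g),l_i(g)\ge0$ and $\sum_i l_i(g)=\sum_i m_i(g)$. Write $\Pi(g)=((m_1(g),l_1(g)),\dots,(m_d(g),l_d(g)))$. $\Sigma_d$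 is the symmetric group on $\{1,\dots,d\}$. The symbol $A_{\sigma(i)}(g)$ depends on both $\sigma$ and $i$ (not just on the value $\sigma(i)$). *)

(* Defs.v *)
From HB Require Import structures.
From mathcomp Require Import all_boot all_order all_algebra all_fingroup.
From mathcomp Require Import boolp classical_sets functions.

Set Implicit Arguments.
Unset Strict Implicit.
Unset Printing Implicit Defensive.

Import Order.TTheory GRing.Theory Num.Theory.
Local Open Scope classical_set_scope.
Local Open Scope ring_scope.

Definition is_least (P : set nat) (n : nat) : Prop :=
  P n /\ forall k, P k -> (n <= k)%N.

Definition is_word_length (M : pzRingType) (S : set M) (g : M) (n : nat) : Prop :=
  is_least [set size w | w in
    [set w : seq M | (forall s, s \in w -> S s) /\ \prod_(s <- w) s = g]] n.

Definition graph_iso (U V : Type) (A : set U) (eA : U -> U -> Prop)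
    (B : set V) (eB : V -> V -> Prop) (phi : U -> V) : Prop :=
  set_bij A B phi /\
  (forall g h, A g -> A h -> (eA g h <-> eB (phi g) (phi h))).

Section Group.
Variables (n : nat) (L : comNzRingType) (lam : 'I_n -> L).
Variables (R : comUnitRingType) (iota : {rmorphism {poly L} -> R}).

(* The image of t + lambda_i in R. *)
Definition tlam (i : 'I_n) : R := iota ('X + (lam i)%:P).

(* R, with iota : L[t] -> R, is the localization L[t, (t + lambda_i)^-1].     *)
(* The t + lambda_i are monic, hence regular in L[t] even when L has zero     *)
(* divisors, so the usual condition on the kernel of iota is injectivity.     *)
Definition is_localization : Prop :=
  [/\ injective iota,
      forall i, tlam i \is a GRing.unit
    & forall r : R, exists (P : {poly L}) (k : 'I_n -> nat),
        r = iota P / \prod_i tlam i ^+ k i].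

Definition affmx (a b : R) : 'M[R]_2 :=
  \matrix_(i, j) if i == 0 then (if j == 0 then a else b)
                 else (if j == 0 then 0 else 1).

Definition Gamma : set 'M[R]_2 :=
  [set g | exists (k : 'I_n -> int) (P : R),
             g = affmx (\prod_i tlam i ^ k i) P].

Definition Sgen : set 'M[R]_2 :=
  [set s | (exists (i : 'I_n) (b : L),
              s = affmx (tlam i) (iota b%:P) \/
              s = (affmx (tlam i) (iota b%:P))^-1)
        \/ (exists (i j : 'I_n) (b : L), i != j /\
              s = affmx (tlam i / tlam j) (- iota b%:P / tlam j))].

Definition cayley_adj (g h : 'M[R]_2) : Prop := exists2 s, Sgen s & h = g * s.

End Group.

Section Graph.
Variables (V : choiceType) (e : rel V).

Definition is_tree : Prop :=
  [/\ symmetric e, irreflexive e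
    & forall x y, exists! p, [/\ path e x p, uniq (x :: p) & last x p = y]].

Definition has_card (P : pred V) (n : nat) : Prop :=
  exists s : seq V, [/\ uniq s, size s = n & s =i P].

(* Edge-path distance (0 if x and y are not connected). *)
Definition gdist (x y : V) : nat :=
  xget 0%N [set n | is_least [set size p | p in
    [set p : seq V | path e x p /\ last x p = y]] n].

End Graph.

Section OrientedTree.
(* The oriented tree is given by its predecessor map v |-> v^-. *)
Variables (V : choiceType) (pr : V -> V).

Definition tadj : rel V := [rel v w | (w == pr v) || (v == pr w)].

(* The two cardinality conditions together force pr (pr v) != v, i.e., each   *)
(* edge is oriented in one direction only.                                    *)
Definition is_oriented_tree (q : nat) : Prop :=
  [/\ is_tree tadj,
      forall v, has_card (tadj v) q.+1
    & forall v, has_card [pred w | pr w == v] q].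

Definition ancestor (a v : V) : Prop := exists n : nat, a = iter n pr v.

(* The greatest common ancestor of v and w is the one that descends from all  *)
(* the others; the default value v is irrelevant in a tree.                   *)
Definition gca (v w : V) : V :=
  xget v [set a | [/\ ancestor a v, ancestor a w
                    & forall b, ancestor b v -> ancestor b w -> ancestor b a]].

Definition mdist (o v : V) : nat := gdist tadj o (gca o v).
Definition ldist (o v : V) : nat := gdist tadj v (gca o v).
Definition height (o v : V) : int := (ldist o v)%:Z - (mdist o v)%:Z.

Variables (d : nat) (o : {ffun 'I_d -> V}).

Definition DL_vertex : set {ffun 'I_d -> V} :=
  [set x | \sum_i height (o i) (x i) = 0].

Definition DL_adj (x y : {ffun 'I_d -> V}) : Prop :=
  exists i j, [/\ i != j, tadj (x i) (y i), tadj (x j) (y j)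
                & forall k, k != i -> k != j -> x k = y k].

End OrientedTree.

Section Formula.
Local Open Scope nat_scope.
Variables (d : nat) (m l : 'I_d -> nat).

(* a_(sigma(j)) with 1-based position j, meaningful for 1 <= j <= d. *)
Definition pos (a : 'I_d -> nat) (sigma : 'S_d) (j : nat) : nat :=
  nth 0 [seq a (sigma i) | i <- enum 'I_d] j.-1.

(* A_(sigma(i)), for 2 <= i <= d. *)
Definition Aterm (sigma : 'S_d) (i : nat) : nat :=
  if i == d then \sum_(1 <= j < d.+1) pos m sigma j
  else \sum_(2 <= j < i.+1) pos m sigma j + \sum_(i <= k < d) pos l sigma k.

Definition fmax (sigma : 'S_d) : nat :=
  \max_(2 <= i < d.+1) (pos m sigma 1 + pos l sigma d + Aterm sigma i).

(* The minimum over all sigma; 'S_d is nonempty, the identity is just the     *)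
(* starting point of the iterated minn.                                       *)
Definition fmin : nat := \big[minn/fmax 1%g]_(sigma : 'S_d) fmax sigma.

End Formula.

(* Main.v *)
Require Import Defs.
From HB Require Import structures.
From mathcomp Require Import all_boot all_order all_algebra all_fingroup.
From mathcomp Require Import boolp classical_sets functions.
From mathcomp Require Import zify.

(** Through the identification with DL_d(q), the word length of g is the distance
    from o to x = (x_1, ..., x_d); moving along an edge, exactly one coordinate
    descends to its predecessor and exactly one ascends.

    Lower bound: the i-th coordinate must visit its meet c_i with o_i, say at time
    t_i.  Sort the coordinates so that t_1 <= ... <= t_d.  Coordinates 1, ..., i have
    made their m_j descents by time t_i, and coordinates i, ..., d still have their
    l_k ascents to make, so the length is at least m_1 + ... + m_i + l_i + ... + l_d.
    Comparing descents and ascents at the times t_j gives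
    t_d >= t_1 + m_1 + ... + m_d, whence the term with i = d.

    Upper bound: for a given order of the coordinates and N = max_i (...), let the
    descents be m_1 steps of coordinate 1, m_2 of coordinate 2, ..., m_d + m_1 of
    coordinate d and then e of coordinate 1, and the ascents be m_1 steps of
    coordinate d, l_1 + e of coordinate 1, l_2 of coordinate 2, ..., l_d of
    coordinate d, where N = m_1 + (m_1 + ... + m_d) + e.  The inequalities defining N
    say precisely that each coordinate finishes descending before it ascends to its
    target. *)

Set Implicit Arguments.
Unset Strict Implicit.
Unset Printing Implicit Defensive.

Import Order.TTheory GRing.Theory Num.Theory.
Local Open Scope classical_set_scope.
Local Open Scope ring_scope.

(** * Ancestors, meets and heights in an oriented tree *)

Section TreeFacts.
Local Open Scope nat_scope.
Variables (V : choiceType) (pr : V -> V) (q : nat).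
Hypothesis hT : is_oriented_tree pr q.

(** Otherwise [pr v] would also be a successor of [v], so the [q.+1] neighbours of [v] would all lie
    among its [q] successors. *)
Lemma pr_no_2cycle v : pr (pr v) <> v.
Proof.
case: hT => _ /(_ v)[s [us szs sE]] /(_ v)[s' [us' szs' s'E]] vv.
suff: size s <= size s' by rewrite szs szs' ltnn.
apply: uniq_leq_size => // x; rewrite sE s'E !inE => /orP[]/eqP -> //.
exact/eqP.
Qed.

(** In a shortest cycle of length at least 3, [v] and the last vertex before the return to [v] are
    joined both by a single edge and by the simple path along [pr], against uniqueness of paths. *)
Lemma pr_acyclic n v : iter n pr v = v -> n = 0.
Proof.
elim/ltn_ind: n v => -[//|[|[|n]]] IH v /= E.
- by case: hT => -[_ irr _] _ _; move: (irr v); rewrite /tadj /= E eqxx.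
- by case: (pr_no_2cycle E).
case: hT => -[_ _ htree] _ _.
set w := iter n.+2 pr v.
have [p [_ puniq]] := htree v w.
have p1 : p = [:: w].
  apply: puniq; split => //=; first by rewrite /tadj /= /w /= E eqxx orbT.
  rewrite inE andbT; apply/eqP => vw.
  by have := IH n.+2 (ltnSn _) v (esym vw).
suff p2 : p = traject pr (pr v) n.+2 by move: p1; rewrite p2.
apply: puniq; split; last by rewrite last_traject.
  apply: sub_path (fpath_traject pr v n.+2) => x y /= /eqP <-.
  by rewrite /tadj /= eqxx.
rewrite -[v :: _]/(traject pr v n.+3) looping_uniq; apply/negP => /trajectP[i lt_i].
rewrite -(subnK (ltnW lt_i)) iterD => /IH; lia.
Qed.

Lemma iter_pr_inj a b v : iter a pr v = iter b pr v -> a = b.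
Proof.
wlog le_ab : a b / a <= b => [wl|].
  by case: (leqP a b) => [|/ltnW] ab E; [|apply/esym]; apply: wl.
by rewrite -(subnK le_ab) iterD => /esym /pr_acyclic ->.
Qed.

(** A descent at the front of the path adds 1 to [i]; an ascent cancels one step of [i], or adds 1
    to [j] when [i] is 0. This yields both the existence of meets and lower bounds on path
    lengths. *)
Lemma path_common_ancestor x p : path (tadj pr) x p ->
  exists i j, iter i pr x = iter j pr (last x p) /\ i + j <= size p.
Proof.
elim: p x => [|y p IH] x /=; first by exists 0, 0.
case/andP=> /orP xy /IH[i [j [E ij]]].
case: xy => /eqP xy; first by exists i.+1, j; rewrite iterSr -xy; split=> //; lia.
case: i E ij => [|i] /= E ij.
  by exists 0, j.+1; rewrite /= xy -E; split=> //; lia.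
by exists i, j; rewrite xy -E -iterSr /=; split=> //; lia.
Qed.

Lemma is_least_inj (P : set nat) a b : is_least P a -> is_least P b -> a = b.
Proof. by case=> Pa la [Pb lb]; apply/eqP; rewrite eqn_leq la ?lb. Qed.

Lemma gdist_iter n x : gdist (tadj pr) x (iter n pr x) = n.
Proof.
rewrite /gdist; set S := (X in is_least X).
have Sn : is_least S n.
  split.
    exists (traject pr (pr x) n); last by rewrite size_traject.
    split; last by rewrite last_traject.
    apply: sub_path (fpath_traject pr x n) => a b /= /eqP <-.
    by rewrite /tadj /= eqxx.
  move=> k [p [hp lp] <-]; have [i [j [E ij]]] := path_common_ancestor hp.
  by move: E; rewrite lp -iterD => /iter_pr_inj; lia.
case: xgetP => [y _ Sy|/(_ n)//]; exact: is_least_inj Sy Sn.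
Qed.

(** The meet is found as the first ancestor of [o] that is also an ancestor of [v]; the last clause
    keeps this minimality. *)
Lemma meetP o v : [/\ gca pr o v = iter (mdist pr o v) pr o,
    gca pr o v = iter (ldist pr o v) pr v
  & forall k n, iter k pr o = iter n pr v -> mdist pr o v <= k].
Proof.
have [[m am] [l al] amax] : [set a | [/\ ancestor pr a o, ancestor pr a v
    & forall b, ancestor pr b o -> ancestor pr b v -> ancestor pr b a]] (gca pr o v).
  apply: xgetPex.
  case: hT => -[_ _ /(_ o v)[p [[hp _ lp] _]]] _ _.
  have [i [j [E _]]] := path_common_ancestor hp.
  have ex : exists i, `[< exists j, iter i pr o = iter j pr v >].
    by exists i; apply/asboolP; exists j; rewrite E lp.
  case: (ex_minnP ex) => k /asboolP[n kn] kmin.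
  exists (iter k pr o); split; [by exists k|by exists n|].
  move=> b [b1 ->] [b2 bE]; exists (b1 - k); rewrite -iterD subnK //.
  by apply: kmin; apply/asboolP; exists b2.
have -> : mdist pr o v = m by rewrite /mdist am gdist_iter.
have -> : ldist pr o v = l by rewrite /ldist al gdist_iter.
split=> // k n E.
have [||j] := amax (iter k pr o); [by exists k|by exists n|].
rewrite am -iterD => /iter_pr_inj; lia.
Qed.

Lemma gca_mdist o v : gca pr o v = iter (mdist pr o v) pr o.
Proof. by case: (meetP o v). Qed.

Lemma gca_ldist o v : gca pr o v = iter (ldist pr o v) pr v.
Proof. by case: (meetP o v). Qed.

(** Beyond the meet both distances grow equally, so any common ancestor computes the height. *)
Lemma heightE o v i j : iter i pr o = iter j pr v ->
  height pr o v = (j%:Z - i%:Z)%R.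
Proof.
move=> E; have [mE lE /(_ _ _ E) le_mi] := meetP o v; rewrite /height.
move: E; rewrite -(subnK le_mi) iterD -mE lE -iterD => /iter_pr_inj; lia.
Qed.

Lemma height_pr o v : height pr o (pr v) = (height pr o v - 1)%R.
Proof.
rewrite (@heightE o (pr v) (mdist pr o v).+1 (ldist pr o v)) /height; first lia.
by rewrite -iterSr /= -gca_mdist gca_ldist.
Qed.

Lemma height_id o : height pr o o = 0%R.
Proof. by rewrite (@heightE o o 0 0). Qed.

Lemma height_gca o v : height pr o (gca pr o v) = (- (mdist pr o v)%:Z)%R.
Proof. by rewrite (@heightE _ _ (mdist pr o v) 0) /= -?gca_mdist ?sub0r. Qed.

(* The descendants of the child of the meet towards o can only be left through
   the meet, and v is not among them. *)
Lemma walk_meet (x : nat -> V) o v N : x 0 = o -> x N = v ->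
  (forall t, t < N -> x t.+1 = x t \/ tadj pr (x t) (x t.+1)) ->
  exists2 t, t <= N & x t = gca pr o v.
Proof.
move=> x0 xN xstep; have [mE _ mmin] := meetP o v.
apply: contrapT => hN; have miss t : t <= N -> x t <> gca pr o v.
  by move=> tN E; apply: hN; exists t.
case: (mdist pr o v) mE mmin => [|m] mE mmin.
  by apply: (miss 0); rewrite // mE x0.
suff H t : t <= N -> exists n, iter m pr o = iter n pr (x t).
  by have [n] := H N (leqnn _); rewrite xN => /mmin; rewrite ltnn.
elim: t => [_|t IH tN]; first by exists m; rewrite x0.
have [n nE] := IH (ltnW tN).
case: (xstep t tN) => [->|/orP[]/eqP E]; first by exists n.
- case: n nE => [/= nE|n]; last by rewrite iterSr -E; exists n.
  by case: (miss _ tN); rewrite E mE /= nE.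
- by exists n.+1; rewrite iterSr -E.
Qed.

(** Supplies ascents of any length, which the optimal walk uses as detours. *)
Lemma pr_iter_surj n v : 0 < q -> exists w, iter n pr w = v.
Proof.
move=> q0; elim: n v => [|n IH] v; first by exists v.
case: hT => _ _ /(_ v)[[|w s] [_ sz sE]]; first by rewrite -sz in q0.
have [z zE] := IH w; exists z; rewrite /= zE; apply/eqP.
by have := sE w; rewrite !inE eqxx.
Qed.

End TreeFacts.

(** * Words in the generators and walks in the Diestel-Leader graph *)

Section Words.
Variables (n : nat) (L : comNzRingType) (lam : 'I_n -> L).
Variables (R : comUnitRingType) (iota : {rmorphism {poly L} -> R}).
Hypothesis tlam_unit : forall i, tlam lam iota i \is a GRing.unit.

Lemma affmxM (a b a' b' : R) :
  affmx a b * affmx a' b' = affmx (a * a') (a * b' + b).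
Proof.
apply/matrixP => i j; rewrite !mxE big_ord_recl big_ord1 !mxE /=.
by case: (i == 0); case: (j == 0);
  rewrite ?(mulr0, mul0r, mulr1, mul1r, addr0, add0r).
Qed.

Lemma affmx10 : affmx 1 0 = 1 :> 'M[R]_2.
Proof.
by apply/matrixP => -[[|[|//]] hi] [[|[|//]] hj]; rewrite !mxE.
Qed.

Lemma affmxV (a b : R) : a \is a GRing.unit ->
  (affmx a b)^-1 = affmx a^-1 (- (a^-1 * b)).
Proof.
move=> ua; have e1 : affmx a b * affmx a^-1 (- (a^-1 * b)) = 1.
  by rewrite affmxM mulrN mulVKr // divrr // addNr affmx10.
have e2 : affmx a^-1 (- (a^-1 * b)) * affmx a b = 1.
  by rewrite affmxM mulVr // subrr affmx10.
have u : affmx a b \is a GRing.unit by apply/unitrP; eexists; split; eassumption.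
by apply: (mulrI u); rewrite divrr.
Qed.

Lemma GammaM g h : Gamma lam iota g -> Gamma lam iota h -> Gamma lam iota (g * h).
Proof.
case=> k [P ->] [k' [P' ->]]; rewrite affmxM.
exists (fun i => k i + k' i); eexists; congr affmx.
by rewrite -big_split /=; apply: eq_bigr => i _; rewrite exprzDr.
Qed.

Lemma Gamma_id : Gamma lam iota 1.
Proof.
exists (fun=> 0), 0; rewrite -affmx10; congr affmx.
by rewrite big1 // => i _; rewrite expr0z.
Qed.

Lemma tlamE i : tlam lam iota i = \prod_j tlam lam iota j ^ ((i == j)%:Z).
Proof.
rewrite (bigD1 i) //= eqxx expr1z big1 ?mulr1 // => j.
by rewrite eq_sym => /negPf->; rewrite expr0z.
Qed.

Lemma tlamVE i : (tlam lam iota i)^-1 = \prod_j tlam lam iota j ^ (- (i == j)%:Z).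
Proof.
rewrite (bigD1 i) //= eqxx big1 ?mulr1 // => j.
by rewrite eq_sym => /negPf->; rewrite oppr0 expr0z.
Qed.

Lemma Sgen_Gamma s : Sgen lam iota s -> Gamma lam iota s.
Proof.
case=> [[i [b [->|->]]]|[i [j [b [_ ->]]]]].
- by eexists; eexists; congr affmx; exact: tlamE.
- by rewrite affmxV //; eexists; eexists; congr affmx; exact: tlamVE.
- exists (fun k => (i == k)%:Z - (j == k)%:Z); eexists; congr affmx.
  rewrite tlamE tlamVE -big_split /=.
  by apply: eq_bigr => k _; rewrite exprzDr.
Qed.

Variables (T : choiceType) (pr : T -> T) (d : nat) (o : {ffun 'I_d -> T}).
Variable phi : 'M[R]_2 -> {ffun 'I_d -> T}.
Hypothesis phi_iso : graph_iso (Gamma lam iota) (cayley_adj lam iota)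
                               (DL_vertex pr o) (@DL_adj T pr d) phi.
Hypothesis phi1 : phi 1 = o.

Definition DL_walk (x : nat -> {ffun 'I_d -> T}) (N : nat) : Prop :=
  [/\ x 0 = o, forall t, (t <= N)%N -> DL_vertex pr o (x t)
    & forall t, (t < N)%N -> DL_adj pr (x t) (x t.+1)].

(** The walk is the image of the prefix products; they stay in [Gamma], where [phi] is an
    isomorphism. *)
Lemma word_walk w : (forall s, s \in w -> Sgen lam iota s) ->
  exists2 x, DL_walk x (size w) & x (size w) = phi (\prod_(s <- w) s).
Proof.
move=> Sw; have [[phiG _ _] phiE] := phi_iso.
pose p t := \prod_(s <- take t w) s.
have pG t : Gamma lam iota (p t).
  rewrite /p big_seq; apply: (big_ind (Gamma lam iota)).
  - exact: Gamma_id.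
  - exact: GammaM.
  - by move=> s /mem_take/Sw/Sgen_Gamma.
exists (phi \o p); last by rewrite /= /p take_size.
split=> [|t _|t lt_t] /=; first by rewrite /p take0 big_nil.
  exact: phiG.
apply/phiE => //; exists (nth 0 w t); first by apply/Sw/mem_nth.
by rewrite /p (take_nth 0) // -cats1 big_cat big_seq1.
Qed.

(** The walk is lifted backwards from [g] by surjectivity of [phi]; injectivity shows that the lift
    starts at 1. *)
Lemma walk_word x N g : DL_walk x N -> Gamma lam iota g -> x N = phi g ->
  exists w, [/\ forall s, s \in w -> Sgen lam iota s, \prod_(s <- w) s = g
              & size w = N].
Proof.
case=> x0 xV xE; have [[_ phi_inj phi_surj] phiE] := phi_iso.
elim: N g xV xE => [|N IH] g xV xE gG xN.
  exists [::]; split=> //; rewrite big_nil; apply: phi_inj; rewrite ?inE //.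
  - exact: Gamma_id.
  - by rewrite phi1 -x0.
have [h hG hN] := phi_surj _ (xV N (leqnSn N)).
have [w [Sw wE sw]] : exists w, [/\ forall s, s \in w -> Sgen lam iota s,
    \prod_(s <- w) s = h & size w = N].
  apply: IH => // t tN; [apply: xV | apply: xE]; exact: leqW.
have [s Ss gE] : cayley_adj lam iota h g.
  by apply/phiE => //; rewrite -xN hN; apply: xE.
exists (rcons w s); split; last by rewrite size_rcons sw.
  by move=> s'; rewrite mem_rcons inE => /orP[/eqP->//|/Sw].
by rewrite -cats1 big_cat big_seq1 wE gE.
Qed.

End Words.

(** * The length formula and the counting argument behind the lower bound *)

Section FormulaFacts.
Local Open Scope nat_scope.
Variable d : nat.
Implicit Types (a m l : 'I_d -> nat) (s : 'S_d).

Lemma pos_ord a s (p : 'I_d) : pos a s p.+1 = a (s p).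
Proof. by rewrite /pos /= (nth_map p) ?size_enum_ord // nth_ord_enum. Qed.

Lemma sum_pos a s i j : j <= d ->
  \sum_(i.+1 <= k < j.+1) pos a s k = \sum_(p < d | i <= p < j) a (s p).
Proof.
move=> le_jd; rewrite big_add1 /= (big_nat_widenl _ 0) // (big_nat_widen _ _ d) //=.
by rewrite big_mkord; apply: eq_bigr => p _; rewrite pos_ord.
Qed.

Lemma sum_pos_all a s : \sum_(1 <= k < d.+1) pos a s k = \sum_p a p.
Proof.
rewrite sum_pos // [RHS](reindex_perm s) /=.
by apply: eq_bigl => p; rewrite ltn_ord.
Qed.

(** For [1 < i < d] the summands [pos m s 1] and [pos l s d] complete the two sums of [Aterm]; for
    [i = d] they stay apart. Both bounds use the maximum in this form. *)
Lemma fmax_leP m l s N : 1 < d ->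
  fmax m l s <= N <->
  pos m s 1 + pos l s d + \sum_p m p <= N /\
  (forall i, 1 < i < d ->
     \sum_(1 <= j < i.+1) pos m s j + \sum_(i <= k < d.+1) pos l s k <= N).
Proof.
move=> d1.
have AE i : 1 < i < d -> pos m s 1 + pos l s d + Aterm m l s i =
    \sum_(1 <= j < i.+1) pos m s j + \sum_(i <= k < d.+1) pos l s k.
  case/andP=> i1 id; rewrite /Aterm ltn_eqF //.
  have -> : \sum_(1 <= j < i.+1) pos m s j = pos m s 1 + \sum_(2 <= j < i.+1) pos m s j.
    by rewrite big_ltn // ltnS ltnW.
  by rewrite [\sum_(_ <= _ < d.+1) _]big_nat_recr ?(ltnW id) //=; lia.
split.
  move/bigmax_leqP_seq => H; split.
    have := H d; rewrite mem_index_iota /Aterm eqxx sum_pos_all; apply => //; lia.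
  by move=> i hi; rewrite -AE //; apply: H; rewrite // mem_index_iota; lia.
case=> Hd Hi; apply/bigmax_leqP_seq => i; rewrite mem_index_iota => hi _.
have [->|ne] := eqVneq i d; first by rewrite /Aterm eqxx sum_pos_all.
by rewrite AE ?Hi //; lia.
Qed.

Lemma fmin_attained m l : exists s, fmin m l = fmax m l s.
Proof.
rewrite /fmin; elim/big_ind: _ => [|x y [s1 ->] [s2 ->]|s _].
- by exists 1%g.
- by case: (leqP (fmax m l s1) (fmax m l s2)) => _; [exists s1|exists s2].
- by exists s.
Qed.

(** Since [minn] has no neutral element on the naturals, the bound is read off by induction on the
    list of permutations. *)
Lemma fmin_le m l s : fmin m l <= fmax m l s.
Proof.
rewrite /fmin; move: (mem_index_enum s); elim: (index_enum _) => // s' r IH.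
rewrite inE big_cons => /orP[/eqP <-|/IH]; first exact: geq_minl.
exact: leq_trans (geq_minr _ _).
Qed.

Lemma sort_perm (t : 'I_d -> nat) :
  exists s : 'S_d, forall i j : 'I_d, i <= j -> t (s i) <= t (s j).
Proof.
pose r := sort (relpre t leq) (enum 'I_d).
have sr : size r = d by rewrite size_sort size_enum_ord.
have ur : uniq r by rewrite sort_uniq enum_uniq.
have inj : injective (fun i : 'I_d => nth i r i).
  move=> i j; rewrite (set_nth_default j) ?sr // => /eqP.
  by rewrite nth_uniq ?sr // => /eqP/val_inj.
exists (perm inj) => i j le_ij; rewrite !permE (set_nth_default j) ?sr //.
have tot : total (relpre t leq) by move=> x y; exact: leq_total.
have tr : transitive (relpre t leq) by move=> x y z; exact: leq_trans.
apply: (sorted_leq_nth tr _ j (sort_sorted tot _)); rewrite ?inE ?sr //=.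
by move=> x; exact: leqnn.
Qed.

(* D j k and U j k stand for the numbers of descents and ascents of coordinate j
   up to time k, and t j for a time at which coordinate j is at its meet. *)
Lemma fmax_lower_bound m l (t : 'I_d -> nat) (D U : 'I_d -> nat -> nat) N :
  1 < d ->
  (forall j, {homo D j : a b / a <= b}) -> (forall j, {homo U j : a b / a <= b}) ->
  (forall k, k <= N -> \sum_j D j k = k) ->
  (forall k, k <= N -> \sum_j U j k = k) ->
  (forall j, t j <= N) ->
  (forall j, D j (t j) = U j (t j) + m j) ->
  (forall j, U j N + m j = D j N + l j) ->
  exists s, fmax m l s <= N.
Proof.
move=> d1 Dmono Umono sumD sumU tN Dt DN; have [s sP] := sort_perm t; exists s.
have reD k : k <= N -> \sum_p D (s p) k = k.
  by move=> kN; rewrite -[RHS]sumD // [RHS](reindex_perm s).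
have reU k : k <= N -> \sum_p U (s p) k = k.
  by move=> kN; rewrite -[RHS]sumU // [RHS](reindex_perm s).
(* Coordinates that reach their meets no earlier than [t (s p0)] have all their [l] ascents, net of
   descents, still ahead; one ascent occurs per unit of time. *)
have after (P : pred 'I_d) (p0 : 'I_d) : (forall p, P p -> p0 <= p) ->
    \sum_(p | P p) l (s p) + t (s p0) <= N.
  move=> P0; rewrite -[X in _ + X]reU // -[leqRHS]reU // big_mkcond /= -big_split /=.
  apply: leq_sum => p _; case: ifP => [/P0/sP le_t|_].
    have := Umono (s p) _ _ le_t; have := Dmono (s p) _ _ (tN (s p)).
    have := DN (s p); have := Dt (s p); lia.
  by apply: Umono.
(* Dually, coordinates already past their meets have made at least [m] descents each. *)
have before (P : pred 'I_d) (p0 : 'I_d) : (forall p, P p -> p <= p0) ->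
    \sum_(p | P p) m (s p) <= t (s p0).
  move=> P0; rewrite -[leqRHS]reD // big_mkcond /=.
  apply: leq_sum => p _; case: ifP => [/P0/sP le_t|//].
  by have := Dmono (s p) _ _ le_t; have := Dt (s p); lia.
pose p0 : 'I_d := Ordinal (ltnW d1).
have hlast : d.-1 < d by lia.
pose pd : 'I_d := Ordinal hlast.
apply/fmax_leP => //; split.
  have -> : pos l s d = l (s pd) by rewrite -pos_ord /= prednK // ltnW.
  rewrite (pos_ord _ _ p0).
  have m0 : m (s p0) <= t (s p0).
    by have := before (pred1 p0) p0; rewrite big_pred1_eq; apply => p /eqP->.
  have ld : l (s pd) + t (s pd) <= N.
    by have := after (pred1 pd) pd; rewrite big_pred1_eq; apply => p /eqP->.
  (* Each coordinate's descents up to the last meeting time exceed its ascents up to the first one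
     by at least its [m]; this is summed over the coordinates. *)
  suff : \sum_p m p + t (s p0) <= t (s pd) by lia.
  rewrite (reindex_perm s) /= -[X in _ + X]reU // -[leqRHS]reD // -big_split /=.
  apply: leq_sum => p _.
  have := Umono (s p) _ _ (sP p0 p (leq0n _)); have := Dt (s p).
  have le_pd : p <= pd by rewrite /= -ltnS prednK // ltnW.
  by have := Dmono (s p) _ _ (sP p pd le_pd); lia.
case=> [//|i] /andP[i1 id]; rewrite !sum_pos ?(ltnW id) //.
have A := after (fun p => i <= p < d) (Ordinal (ltnW id)).
have B := before (fun p => 0 <= p < i.+1) (Ordinal (ltnW id)).
have {}A := A (fun p h => proj1 (andP h)); have {}B := B (fun p h => h).
by apply: leq_trans A; rewrite addnC leq_add2l.
Qed.

End FormulaFacts.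

(** * Descents and ascents along a walk, and the lower bound *)

Section LowerBound.
Variables (V : choiceType) (pr : V -> V) (q : nat).
Hypothesis hT : is_oriented_tree pr q.
Variables (d : nat) (o : {ffun 'I_d -> V}).

Lemma sum_height_change (x y : {ffun 'I_d -> V}) i j :
  i != j -> (forall k, k != i -> k != j -> x k = y k) ->
  \sum_k height pr (o k) (y k) - \sum_k height pr (o k) (x k) =
  (height pr (o i) (y i) - height pr (o i) (x i)) +
  (height pr (o j) (y j) - height pr (o j) (x j)).
Proof.
move=> ij xy; rewrite -sumrB (bigD1 i) //= (bigD1 j) ?(eq_sym j) //=.
by rewrite addrA big1 ?addr0 // => k /andP[ki kj]; rewrite xy // subrr.
Qed.

(** Two moves in the same direction would change the height sum by 2 or -2. *)
Lemma DL_adj_step x y : DL_vertex pr o x -> DL_vertex pr o y -> DL_adj pr x y ->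
  exists i j, [/\ i != j, y i = pr (x i), x j = pr (y j)
    & forall k, k != i -> k != j -> x k = y k].
Proof.
move=> Vx Vy [i [j [ij ai aj xy]]].
have := sum_height_change ij xy; rewrite Vx Vy.
have xy' k : k != j -> k != i -> x k = y k by move=> *; exact: xy.
case/orP: ai => /eqP Ei; case/orP: aj => /eqP Ej; rewrite Ei Ej !(height_pr hT);
  try lia.
- by move=> _; exists i, j.
- by move=> _; exists j, i; rewrite eq_sym.
Qed.

Definition descents (x : nat -> {ffun 'I_d -> V}) (j : 'I_d) (t : nat) : nat :=
  \sum_(k < t) (x k.+1 j == pr (x k j)).

Definition ascents (x : nat -> {ffun 'I_d -> V}) (j : 'I_d) (t : nat) : nat :=
  \sum_(k < t) (x k j == pr (x k.+1 j)).

Lemma sum_ord_homo (F : nat -> nat) :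
  {homo (fun t => \sum_(k < t) F k)%N : a b / (a <= b)%N}.
Proof.
move=> a b ab; rewrite (big_ord_widen b) // big_mkcond leq_sum // => k _.
by case: ifP.
Qed.

Lemma pr_fixF v : (v == pr v) = false.
Proof. by apply/eqP => E; have := @pr_acyclic _ _ _ hT 1 v (esym E). Qed.

Lemma pr_2cycleF v : (v == pr (pr v)) = false.
Proof. by apply/eqP => E; have := @pr_acyclic _ _ _ hT 2 v (esym E). Qed.

Section Walk.
Variables (x : nat -> {ffun 'I_d -> V}) (N : nat).
Hypothesis xP : DL_walk pr o x N.

Lemma DL_walk_step t : (t < N)%N -> exists i j, [/\ i != j,
    x t.+1 i = pr (x t i), x t j = pr (x t.+1 j)
    & forall k, k != i -> k != j -> x t k = x t.+1 k].
Proof.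
by case: xP => _ xV xE tN; apply: DL_adj_step; [exact/xV/ltnW|exact: xV|exact: xE].
Qed.

Lemma step_one t : (t < N)%N ->
  (\sum_j (x t.+1 j == pr (x t j)) = 1)%N /\ (\sum_j (x t j == pr (x t.+1 j)) = 1)%N.
Proof.
move=> /DL_walk_step[i [j [ij Ei Ej E]]]; split.
  rewrite (bigD1 i) //= Ei eqxx big1 // => k ki; have [->|kj] := eqVneq k j.
    by rewrite Ej pr_2cycleF.
  by rewrite -E // pr_fixF.
rewrite (bigD1 j) //= Ej eqxx big1 // => k kj; have [->|ki] := eqVneq k i.
  by rewrite Ei pr_2cycleF.
by rewrite -E // pr_fixF.
Qed.

Lemma sum_descents t : (t <= N)%N -> (\sum_j descents x j t = t)%N.
Proof.
move=> tN; rewrite exchange_big /= -[RHS]card_ord -sum1_card.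
by apply: eq_bigr => k _; have [] := step_one (leq_trans (ltn_ord k) tN).
Qed.

Lemma sum_ascents t : (t <= N)%N -> (\sum_j ascents x j t = t)%N.
Proof.
move=> tN; rewrite exchange_big /= -[RHS]card_ord -sum1_card.
by apply: eq_bigr => k _; have [] := step_one (leq_trans (ltn_ord k) tN).
Qed.

Lemma height_walk j t : (t <= N)%N ->
  height pr (o j) (x t j) = (ascents x j t)%:Z - (descents x j t)%:Z.
Proof.
elim: t => [_|t IH tN].
  by case: xP => -> _ _; rewrite (height_id hT) /ascents /descents !big_ord0.
have {IH} := IH (ltnW tN); rewrite /ascents /descents !big_ord_recr /=.
have [i [k [ik Ei Ek E]]] := DL_walk_step tN.
have [->|ji] := eqVneq j i.
  by rewrite Ei pr_2cycleF eqxx (height_pr hT) => ->; lia.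
have [->|jk] := eqVneq j k.
  by rewrite Ek pr_2cycleF eqxx (height_pr hT) => E'; lia.
by rewrite -E // pr_fixF => ->; lia.
Qed.

Lemma DL_walk_lower_bound : (1 < d)%N -> exists s,
  (fmax (fun i => mdist pr (o i) (x N i)) (fun i => ldist pr (o i) (x N i)) s <= N)%N.
Proof.
move=> d1; have [x0 xV xE] := xP.
have ex j : exists t, (t <= N)%N /\ x t j = gca pr (o j) (x N j).
  have x0j : x 0 j = o j by rewrite x0.
  suff step t : (t < N)%N -> x t.+1 j = x t j \/ tadj pr (x t j) (x t.+1 j).
    by have [t tN tE] := walk_meet hT x0j erefl step; exists t.
  move=> /DL_walk_step[i [k [ik Ei Ek E]]].
  have [->|ji] := eqVneq j i; first by right; rewrite /tadj /= Ei eqxx.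
  have [->|jk] := eqVneq j k; first by right; rewrite /tadj /= -Ek eqxx orbT.
  by left; rewrite E.
have [t tP] := choice ex.
apply: (@fmax_lower_bound _ _ _ t (descents x) (ascents x)) => //.
- by move=> j; apply: sum_ord_homo (fun k => (x k.+1 j == pr (x k j)) : nat).
- by move=> j; apply: sum_ord_homo (fun k => (x k j == pr (x k.+1 j)) : nat).
- exact: sum_descents.
- exact: sum_ascents.
- by move=> j; case: (tP j).
(* The height is [-m] at the meet, and [l - m] at the end of the walk; these give the last two
   conditions. *)
- move=> j; have [tN tE] := tP j; have := height_walk j tN.
  by rewrite tE (height_gca hT); lia.
- by move=> j; have := height_walk j (leqnn N); rewrite /height; lia.
Qed.

End Walk.
End LowerBound.

(* The zigzag in a tree that ascends u steps to y by time u, descends w steps from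
   time b on, ascends v steps to z from time a on, and descends e steps from time c
   on, resting in between. *)
Section Zigzag.
Local Open Scope nat_scope.
Variables (V : choiceType) (pr : V -> V) (y z : V) (u w v e b a c : nat).

Definition zigzag (t : nat) : V :=
  if t <= b then iter (u - t) pr y
  else if t <= a then iter (minn (t - b) w) pr y
  else if t <= c then iter (v - (t - a)) pr z
  else iter (minn (t - c) e) pr z.

Hypotheses (ub : u <= b) (ba : b + w <= a) (ac : a + v <= c).
Hypothesis yz : iter w pr y = iter v pr z.

(** Neighbouring clauses of [zigzag] agree at their common time, so each formula holds on a closed
    interval and covers both ends of a step. *)
Lemma zigzag_12 t : b <= t <= a -> zigzag t = iter (minn (t - b) w) pr y.
Proof.
move=> h; rewrite /zigzag; case: leqP => h1; last by case: leqP => //; lia.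
by congr (iter _ pr y); lia.
Qed.

Lemma zigzag_23 t : a <= t <= c -> zigzag t = iter (v - (t - a)) pr z.
Proof.
move=> h; have [E|ne] := eqVneq t a.
  rewrite zigzag_12; last by lia.
  have -> : minn (t - b) w = w by lia.
  by rewrite yz; congr (iter _ pr z); lia.
rewrite /zigzag; case: leqP => h1; first by lia.
by case: leqP => h2; [lia|case: leqP => //; lia].
Qed.

Lemma zigzag_34 t : c <= t -> zigzag t = iter (minn (t - c) e) pr z.
Proof.
move=> h; have [E|ne] := eqVneq t c.
  by rewrite zigzag_23; [congr (iter _ pr z)|]; lia.
rewrite /zigzag; case: leqP => h1; first by lia.
by case: leqP => h2; [lia|case: leqP => //; lia].
Qed.

Definition zig_down (t : nat) : bool := (b <= t < b + w) || (c <= t < c + e).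
Definition zig_up (t : nat) : bool := (t < u) || (a <= t < a + v).

Lemma zigzag_step t :
  [/\ zig_down t -> zigzag t.+1 = pr (zigzag t),
      zig_up t -> zigzag t = pr (zigzag t.+1)
    & ~~ zig_down t -> ~~ zig_up t -> zigzag t = zigzag t.+1].
Proof.
rewrite /zig_down /zig_up.
have [h|h] := ltnP t b.
  have E k : k <= b -> zigzag k = iter (u - k) pr y by rewrite /zigzag => ->.
  rewrite !E ?(ltnW h) // -!iterS; split; try lia.
    by move=> ?; congr (iter _ pr y); lia.
  by move=> ? ?; congr (iter _ pr y); lia.
have [h2|h2] := ltnP t a.
  rewrite !zigzag_12 -?iterS; try lia; split; try lia.
    by move=> ?; congr (iter _ pr y); lia.
  by move=> ? ?; congr (iter _ pr y); lia.
have [h3|h3] := ltnP t c.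
  rewrite !zigzag_23 -?iterS; try lia; split; try lia.
    by move=> ?; congr (iter _ pr z); lia.
  by move=> ? ?; congr (iter _ pr z); lia.
rewrite !zigzag_34 -?iterS; try lia; split; try lia.
  by move=> ?; congr (iter _ pr z); lia.
by move=> ? ?; congr (iter _ pr z); lia.
Qed.

Lemma zigzag0 : zigzag 0 = iter u pr y.
Proof. by rewrite /zigzag leq0n subn0. Qed.

Lemma zigzag_end : zigzag (c + e) = iter e pr z.
Proof. by rewrite zigzag_34 ?leq_addr //; congr (iter _ pr z); lia. Qed.

End Zigzag.

Lemma interval_find (F : nat -> nat) n t : (F 0 <= t < F n)%N ->
  exists2 p, (p < n)%N & (F p <= t < F p.+1)%N.
Proof.
elim: n => [|n IH]; first by lia.
case: (ltnP t (F n)) => [h1 /andP[h0 _]|h1 /andP[h0 h2]].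
  by case: IH => [|p pn]; [rewrite h0|exists p; rewrite // ltnS ltnW].
by exists n; rewrite // h1.
Qed.

(** * The schedule: at each time one coordinate descends and another ascends *)

Section Schedule.
Local Open Scope nat_scope.
Variables (d N : nat) (m l : nat -> nat).
Let M p := \sum_(0 <= k < p) m k.
Let Lam p := \sum_(p <= k < d) l k.
Hypotheses (d1 : 1 < d) (ml : Lam 0 = M d).
Hypothesis N_ge_ends : m 0 + l d.-1 + M d <= N.
Hypothesis N_ge_mid : forall p, 0 < p < d.-1 -> M p.+1 + Lam p <= N.
Hypothesis N_le : N <= M d + m 0 + Lam 1.

(* The parameters u, e, b, a, c of the zigzag of the coordinate in position p; the
   positions are numbered from 0 to d - 1. *)
Definition sched_u p := if p == d.-1 then m 0 else 0.
Definition sched_e p := if p == 0 then N - (M d + m 0) else 0.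
Definition sched_b p := M p.
Definition sched_a p := if p == 0 then m 0 else N - Lam p.
Definition sched_c p := if p == 0 then M d + m 0 else N.
Definition sched_down p :=
  zig_down (sched_u p + m p) (sched_e p) (sched_b p) (sched_c p).
Definition sched_up p :=
  zig_up (sched_u p) (l p + sched_e p) (sched_a p).

Let M0 : M 0 = 0. Proof. by rewrite /M big_nil. Qed.
Let MS p : M p.+1 = M p + m p. Proof. by rewrite /M big_nat_recr. Qed.
Let M_homo : {homo M : p r / p <= r}.
Proof. by apply: homo_leq => // [? ? ?|p]; [exact: leq_trans|rewrite MS leq_addr]. Qed.
Let LamS p : p < d -> Lam p = l p + Lam p.+1.
Proof. by move=> pd; rewrite /Lam big_ltn. Qed.
Let Lamd : Lam d = 0. Proof. by rewrite /Lam big_geq. Qed.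
Let Lam_homo p r : p <= r -> r <= d -> Lam r <= Lam p.
Proof. by move=> pr rd; rewrite [leqRHS](big_cat_nat pr rd) /= leq_addl. Qed.

(** The decisive inequality is [N_le] for the first position, where the ascent must end before the
    final descent, [N_ge_mid] for the middle ones, and [N_ge_ends] for the last. *)
Lemma sched_ok p : p < d ->
  [/\ sched_u p <= sched_b p, sched_b p + (sched_u p + m p) <= sched_a p,
      sched_a p + (l p + sched_e p) <= sched_c p & sched_c p + sched_e p = N].
Proof.
move=> pd; rewrite /sched_u /sched_b /sched_a /sched_c /sched_e.
have L0 := LamS (ltnW d1); have M1 := MS 0.
have ML := MS d.-1; have LL : Lam d.-1 = l d.-1 + Lam d.-1.+1 by apply: LamS; lia.
rewrite prednK ?(ltnW d1) // in ML LL.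
have M1d : M 1 <= M d.-1 by apply: M_homo; lia.
have Lp := LamS pd; have Mp := MS p; have Lp0 := Lam_homo (leq0n p) (ltnW pd).
have Npd : 0 < p < d.-1 -> M p.+1 + Lam p <= N by exact: N_ge_mid.
have [p0|p0] := eqVneq p 0; have [pl|pl] := eqVneq p d.-1; subst; split; lia.
Qed.

Lemma sched_disj p t : p < d -> sched_down p t -> ~~ sched_up p t.
Proof.
move=> pd; have [] := sched_ok pd.
by rewrite /sched_down /sched_up /zig_down /zig_up; lia.
Qed.

(** The descents tile the time in the order 0, ..., [d.-1], 0, the cuts being the values of [M]
    below [d] and then [M d + m 0]. *)
Lemma sched_down_ex t : t < N -> exists2 p, p < d & sched_down p t.
Proof.
move=> tN; rewrite /sched_down /zig_down /sched_u /sched_b /sched_c /sched_e.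
have ML := MS d.-1; rewrite prednK ?(ltnW d1) // in ML.
case: (leqP (M d + m 0) t) => h; first by exists 0; rewrite ?eqxx; lia.
have d0 : (d.-1 == 0) = false by lia.
case: (leqP (M d.-1) t) => h2; first by exists d.-1; rewrite ?d0 ?eqxx; lia.
have [|p pd hp] := @interval_find M d.-1 t; first by rewrite M0.
by exists p; rewrite ?(ltn_eqF pd); have := MS p; lia.
Qed.

(** The ascents tile the time in the order [d.-1], 0, 1, ..., [d.-1], the cuts being [m 0] and then
    [N - Lam p]. *)
Lemma sched_up_ex t : t < N -> exists2 p, p < d & sched_up p t.
Proof.
move=> tN; rewrite /sched_up /zig_up /sched_u /sched_a /sched_e.
have L0 := LamS (ltnW d1).
have d0 : (d.-1 == 0) = false by lia.
case: (ltnP t (m 0)) => h; first by exists d.-1; rewrite ?d0 ?eqxx; lia.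
case: (ltnP t (N - Lam 1)) => h2; first by exists 0; rewrite ?eqxx; lia.
(* The shift in [Lam k.+1] skips position 0, so block [p] belongs to position [p.+1]. *)
have [|p pd hp] := @interval_find (fun k => N - Lam k.+1) d.-1 t.
  by rewrite prednK ?(ltnW d1) // Lamd subn0 tN h2.
have pd' : p.+1 < d by lia.
exists p.+1 => /=; first by []. by have := LamS pd'; move: hp => /= hp; lia.
Qed.

Lemma sched_down_uniq p r t : p < d -> r < d -> t < N ->
  sched_down p t -> sched_down r t -> p = r.
Proof.
wlog lt_pr : p r / p < r => [wl|] pd rd tN.
  case: (ltngtP p r) => // h A B; first exact: (wl _ _ h pd rd tN A B).
  by rewrite (wl _ _ h rd pd tN B A).
have M1 := M_homo lt_pr; have M2 := M_homo rd; have Mp := MS p; have Mr := MS r.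
rewrite /sched_down /zig_down /sched_u /sched_b /sched_c /sched_e.
have -> : (r == 0) = false by lia.
have -> : (p == d.-1) = false by lia.
by case: (p == 0); case: (r == d.-1); lia.
Qed.

Lemma sched_up_uniq p r t : p < d -> r < d -> t < N ->
  sched_up p t -> sched_up r t -> p = r.
Proof.
wlog lt_pr : p r / p < r => [wl|] pd rd tN.
  case: (ltngtP p r) => // h A B; first exact: (wl _ _ h pd rd tN A B).
  by rewrite (wl _ _ h rd pd tN B A).
have M1 := Lam_homo lt_pr (ltnW rd); have Lp := LamS pd; have Lr := LamS rd.
have [_ _ _ E] := sched_ok (ltnW d1).
have [u1 u2 u3 _] := sched_ok pd; have [v1 v2 v3 _] := sched_ok rd.
have M10 : m 0 <= M d by have := M_homo (ltnW d1); have := MS 0; lia.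
have Mp : p != 0 -> m 0 <= M p.
  by rewrite -lt0n => /M_homo; have := MS 0; lia.
(* This makes the truncated difference [N - Lam p] a true one. *)
have MN : Lam p <= N by have := Lam_homo (leq0n p) (ltnW pd); lia.
have L0 := LamS (ltnW d1).
move: u1 u2 u3 v1 v2 v3.
rewrite /sched_up /zig_up /sched_u /sched_a /sched_e /sched_b /sched_c.
have -> : (r == 0) = false by lia.
have -> : (p == d.-1) = false by lia.
have [p0|p0] := eqVneq p 0; have [r0|r0] := eqVneq r d.-1; subst; lia.
Qed.

Lemma sched_step t : t < N -> exists p r,
  [/\ p < d, r < d & [/\ p != r, sched_down p t, sched_up r t
    & forall k, k < d -> k != p -> k != r -> ~~ sched_down k t /\ ~~ sched_up k t]].
Proof.
move=> tN; have [p pd pt] := sched_down_ex tN; have [r rd rt] := sched_up_ex tN.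
exists p, r; do 2![split=> //].
  by apply: contraTneq rt => <-; exact: sched_disj pt.
move=> k kd kp kr; split; apply/negP => h.
  by rewrite (sched_down_uniq kd pd tN h pt) eqxx in kp.
by rewrite (sched_up_uniq kd rd tN h rt) eqxx in kr.
Qed.

End Schedule.

(** * The walk that attains the bound for a given order *)

Section UpperBound.
Variables (V : choiceType) (pr : V -> V) (q : nat).
Hypothesis hT : is_oriented_tree pr q.
Hypothesis q0 : (0 < q)%N.
Variables (d : nat) (o x : {ffun 'I_d -> V}).
Hypothesis d1 : (1 < d)%N.
Hypothesis xV : DL_vertex pr o x.

Let mx i := mdist pr (o i) (x i).
Let lx i := ldist pr (o i) (x i).

Lemma DL_vertex_sum : (\sum_i mx i = \sum_i lx i)%N.
Proof.
apply/eqP; rewrite -eqz_nat eq_sym -subr_eq0 !(big_morph Posz PoszD erefl) -sumrB.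
exact/eqP/xV.
Qed.

Lemma DL_step_vertex (y y' : {ffun 'I_d -> V}) i j :
  i != j -> y' i = pr (y i) -> y j = pr (y' j) ->
  (forall k, k != i -> k != j -> y k = y' k) ->
  DL_vertex pr o y -> DL_vertex pr o y'.
Proof.
move=> ij Ei Ej E; rewrite /DL_vertex /= => Vy.
have := sum_height_change pr o ij E; rewrite Vy Ei Ej !(height_pr hT) subr0 => ->.
lia.
Qed.

Lemma fmax_DL_walk (s : 'S_d) : exists2 X, DL_walk pr o X (fmax mx lx s)
  & X (fmax mx lx s) = x.
Proof.
set N := fmax mx lx s.
pose m k := pos mx s k.+1; pose l k := pos lx s k.+1.
have ME i : (\sum_(1 <= j < i.+1) pos mx s j = \sum_(0 <= k < i) m k)%N.
  by rewrite big_add1.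
have LE i : (\sum_(i.+1 <= j < d.+1) pos lx s j = \sum_(i <= k < d) l k)%N.
  by rewrite big_add1.
have dE : d.-1.+1 = d by rewrite prednK // ltnW.
have lE : pos lx s d = l d.-1 by rewrite /l dE.
have MdE : (\sum_(0 <= k < d) m k = \sum_i mx i)%N by rewrite -ME sum_pos_all.
have LdE : (\sum_(0 <= k < d) l k = \sum_(0 <= k < d) m k)%N.
  by rewrite MdE -LE sum_pos_all DL_vertex_sum.
have [/(_ (leqnn _))[N1 N2] _] := fmax_leP mx lx s N d1.
rewrite -MdE lE in N1.
have {}N2 p : (0 < p < d.-1 -> \sum_(0 <= k < p.+1) m k + \sum_(p <= k < d) l k <= N)%N.
  by move=> hp; rewrite -ME -LE; apply: N2; lia.
(* As [N] is a maximum, it suffices to bound each of its terms. *)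
have N3 : (N <= \sum_(0 <= k < d) m k + m 0 + \sum_(1 <= k < d) l k)%N.
  apply/fmax_leP => //; rewrite -MdE lE; split.
    have : (l d.-1 <= \sum_(1 <= k < d) l k)%N.
      have h : (1 <= d.-1)%N by lia.
      by have := big_nat_recr d.-1 1 l h; rewrite dE /= => ->; exact: leq_addl.
    rewrite /m; lia.
  case=> [//|i] hi; rewrite ME LE.
  have h1 : (i.+1 <= d)%N by lia.
  have h2 : (1 <= i)%N by lia.
  have h3 : (i <= d)%N by lia.
  by rewrite [in leqRHS](big_cat_nat (leq0n _) h1) [in leqRHS](big_cat_nat h2 h3) /=; lia.
(* The turning points of the zigzag: the first lies [sched_u] ascents above the origin, the second
   [sched_e] ascents above the target. *)
have ex (p : 'I_d) : exists yz : V * V,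
    iter (sched_u d m p) pr yz.1 = o (s p) /\ iter (sched_e d N m p) pr yz.2 = x (s p).
  have [y yE] := pr_iter_surj hT (sched_u d m p) (o (s p)) q0.
  have [z zE] := pr_iter_surj hT (sched_e d N m p) (x (s p)) q0.
  by exists (y, z).
have [yz yzP] := choice ex.
pose Z (p : 'I_d) := zigzag pr (yz p).1 (yz p).2 (sched_u d m p)
  (sched_u d m p + m p) (l p + sched_e d N m p) (sched_e d N m p)
  (sched_b m p) (sched_a d N m l p) (sched_c d N m p).
pose X t : {ffun 'I_d -> V} := [ffun j => Z ((s^-1)%g j) t].
have XE t p : X t (s p) = Z p t by rewrite ffunE permK.
have ok (p : 'I_d) := sched_ok d1 LdE N1 N2 N3 (ltn_ord p).
(* Both sides are the meet of origin and target, where the two arms of the zigzag join. *)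
have yzE (p : 'I_d) : iter (sched_u d m p + m p) pr (yz p).1 =
             iter (l p + sched_e d N m p) pr (yz p).2.
  have [yE zE] := yzP p.
  rewrite addnC iterD yE iterD zE /m /l !pos_ord.
  by rewrite -(gca_mdist hT) (gca_ldist hT).
have step t : (t < N)%N -> exists i j, [/\ i != j,
    X t.+1 i = pr (X t i), X t j = pr (X t.+1 j)
    & forall k, k != i -> k != j -> X t k = X t.+1 k].
  move=> tN.
  have [p [r [pd rd [pr_ne pt rt other]]]] := sched_step d1 LdE N1 N2 N3 tN.
  have zs k := let: And4 ub ba ac _ := ok k in
    zigzag_step (sched_e d N m k) ub ba ac (yzE k) t.
  exists (s (Ordinal pd)), (s (Ordinal rd)); split.
  - by rewrite (inj_eq perm_inj).
  - by rewrite !XE; case: (zs (Ordinal pd)) => + _ _; apply.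
  - by rewrite !XE; case: (zs (Ordinal rd)) => _ + _; apply.
  - move=> k; rewrite -[k](permKV s) !(inj_eq perm_inj) => kp kr; rewrite !XE.
    have [nd nu] := other _ (ltn_ord ((s^-1)%g k)) kp kr.
    by case: (zs ((s^-1)%g k)) => _ _; apply.
exists X.
  have X0 : X 0 = o.
    apply/ffunP => j; rewrite -[j](permKV s) XE /Z zigzag0.
    by case: (yzP ((s^-1)%g j)).
  split=> // [t|t tN].
    elim: t => [_|t IH tN].
      by rewrite X0 /DL_vertex /= big1 // => i _; rewrite (height_id hT).
    have [i [j [ij Ei Ej E]]] := step t tN.
    exact: DL_step_vertex ij Ei Ej E (IH (ltnW tN)).
  have [i [j [ij Ei Ej E]]] := step t tN.
  by exists i, j; split; rewrite // /tadj /= ?Ei -?Ej eqxx ?orbT.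
apply/ffunP => j; rewrite -[j](permKV s) XE.
have [h1 h2 h3 <-] := ok ((s^-1)%g j).
by rewrite /Z zigzag_end //; case: (yzP ((s^-1)%g j)).
Qed.

End UpperBound.

Theorem mainTheorem1 (d q : nat) (hd : (2 <= d)%N) (hq : (2 <= q)%N)
  (hdq : [\/ d = 2%N, d = 3%N
           | (4 <= d)%N /\ forall p : nat, prime p -> (p %| q)%N -> (d.-1 < p)%N])
  (L : finComUnitRingType) (hL : #|L| = q)
  (lam : 'I_d.-1 -> L) (hlam : injective lam)
  (hdiff : (3 <= d)%N -> forall i j, i != j -> lam i - lam j \is a GRing.unit)
  (R : comUnitRingType) (iota : {rmorphism {poly L} -> R})
  (hR : is_localization lam iota)
  (T : choiceType) (pr : T -> T) (hT : is_oriented_tree pr q)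
  (o : {ffun 'I_d -> T})
  (phi : 'M[R]_2 -> {ffun 'I_d -> T})
  (hphi : graph_iso (Gamma lam iota) (cayley_adj lam iota)
                    (DL_vertex pr o) (@DL_adj T pr d) phi)
  (hphi1 : phi 1 = o)
  (g : 'M[R]_2) (hg : Gamma lam iota g) :
  is_word_length (Sgen lam iota) g
    (fmin (fun i => mdist pr (o i) (phi g i)) (fun i => ldist pr (o i) (phi g i))).
Proof.
have [_ tlam_unit _] := hR; split.
  have [s ->] := fmin_attained
    (fun i => mdist pr (o i) (phi g i)) (fun i => ldist pr (o i) (phi g i)).
  have gV : DL_vertex pr o (phi g) by have [[phiG _ _] _] := hphi; exact: phiG.
  have [X XP XN] := fmax_DL_walk hT (ltnW hq) hd gV s.
  by have [w [Sw wE wN]] := walk_word hphi hphi1 XP hg XN; exists w.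
move=> _ [w [Sw wE] <-].
have [X XP XN] := word_walk tlam_unit hphi hphi1 Sw.
have [s] := DL_walk_lower_bound hT XP hd; rewrite XN wE.
exact: leq_trans (fmin_le _ _ _).
Qed.
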